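(* Let $\mathcal{A}\in\mathcal{H}(s_{0,1},s_{0,2},s_{1,2})$ be a complete general triangular arrangement in $\mathbb{P}^2$ with $s_{0,1}\le s_{0,2}\le s_{1,2}$. Then $\mathrm{indeg}(\mathrm{syz}(J_{\mathcal{A}}))=s_{0,1}+s_{0,2}+1$.
   Context: $\Bbbk$ is an algebraically closed field of characteristic $0$, $R=\Bbbk[x_0,x_1,x_2]$, $\mathbb{P}^2=\mathrm{Proj}(R)$. For a line arrangement $\mathcal{A}$ (finite set of distinct lines in $\mathbb{P}^2$), $f_{\mathcal{A}}$ is the product of linear forms defining its lines, $J_{\mathcal{A}}=(\partial_{x_0}f_{\mathcal{A}},\partial_{x_1}f_{\mathcal{A}},\partial_{x_2}f_{\mathcal{A}})$ is its Jacobian ideal, and $\mathrm{syz}(J_{\mathcal{A}})=\{(g_0,g_1,g_2)\in R^{3}:\sum_i g_i\,\partial_{x_i}f_{\mathcal{A}}=0\}$, graded so that a syzygy has degree $d$ when all $g_i\in R_d$. For a graded module $M$, $\mathrm{indeg}(M)$ is the minimum degree of a nonzero homogeneous element. A triangular arrangement is a line arrangement in $\mathbb{P}^2$ all of whose lines pass through at least one of the three coordinate points $\{x_i=x_j=0\}$, $0\le i<j\le 2$; it is complete if it contains the three lines $x_0=0$, $x_1=0$, $x_2=0$. For integers $s_{i,j}\ge 1$, $\mathcal{H}(s_{0,1},s_{0,2},s_{1,2})$ is the set of complete triangular arrangements with exactly $s_{i,j}+2$ lines through the point $\{x_i=x_j=0\}$ for all $0\le i<j\le 2$. A complete triangular arrangement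 is general if any intersection of its lines outside the coordinate triangle has minimal dimension, i.e. no three lines of $\mathcal{A}$ meet in a point lying off the three coordinate lines. *)

(* Defs.v *)
From HB Require Import structures.
From mathcomp Require Import all_boot all_order all_algebra.
From mathcomp Require Import mpoly.

Set Implicit Arguments.
Unset Strict Implicit.
Unset Printing Implicit Defensive.

Import GRing.Theory.
Local Open Scope ring_scope.

Definition i0 : 'I_3 := @Ordinal 3 0 isT.
Definition i1 : 'I_3 := @Ordinal 3 1 isT.
Definition i2 : 'I_3 := @Ordinal 3 2 isT.

(* A line of P^2 is given by a defining linear form in R = {mpoly K[3]}, which
   is unique up to a nonzero scalar; a point of P^2 is given by a nonzero
   vector of homogeneous coordinates 'I_3 -> K. *)

Definition same_line (K : fieldType) (l m : {mpoly K[3]}) : Prop :=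
  exists2 c : K, c != 0 & l = c *: m.

Definition line_arrangement (K : fieldType) (A : seq {mpoly K[3]}) : Prop :=
  [/\ uniq A,
      {in A, forall l, l != 0 /\ l \is 1.-homog}
    & {in A &, forall l m, same_line l m -> l = m}].

Definition through (K : fieldType) (v : 'I_3 -> K) (l : {mpoly K[3]}) : bool :=
  l.@[v] == 0.

(* The point {x_i = x_j = 0}, for i != j. *)
Definition coord_pt (K : fieldType) (i j : 'I_3) : 'I_3 -> K :=
  fun k => ((k != i) && (k != j))%:R.

Definition triangular (K : fieldType) (A : seq {mpoly K[3]}) : Prop :=
  line_arrangement A /\
  {in A, forall l, exists i j : 'I_3, (i < j)%N /\ through (coord_pt K i j) l}.

Definition complete (K : fieldType) (A : seq {mpoly K[3]}) : Prop :=
  forall i : 'I_3, exists2 l, l \in A & same_line l 'X_i.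

Definition lines_through (K : fieldType) (A : seq {mpoly K[3]})
    (v : 'I_3 -> K) : nat :=
  count (through v) A.

Definition in_H (K : fieldType) (s01 s02 s12 : nat)
    (A : seq {mpoly K[3]}) : Prop :=
  [/\ triangular A,
      complete A,
      lines_through A (coord_pt K i0 i1) = (s01 + 2)%N,
      lines_through A (coord_pt K i0 i2) = (s02 + 2)%N
    & lines_through A (coord_pt K i1 i2) = (s12 + 2)%N].

Definition general (K : fieldType) (A : seq {mpoly K[3]}) : Prop :=
  forall (l1 l2 l3 : {mpoly K[3]}) (v : 'I_3 -> K),
    l1 \in A -> l2 \in A -> l3 \in A -> uniq [:: l1; l2; l3] ->
    (forall i, v i != 0) ->
    ~ [/\ through v l1, through v l2 & through v l3].

Definition arr_poly (K : fieldType) (A : seq {mpoly K[3]}) : {mpoly K[3]} :=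
  \prod_(l <- A) l.

Definition jacobian_gens (K : fieldType) (f : {mpoly K[3]}) :
    'rV[{mpoly K[3]}]_3 :=
  \row_i f^`M(i).

Definition syz (K : fieldType) (h : 'rV[{mpoly K[3]}]_3) :
    'rV[{mpoly K[3]}]_3 -> Prop :=
  fun g => \sum_i g 0 i * h 0 i = 0.

Definition homog_vec (K : fieldType) (d : nat)
    (g : 'rV[{mpoly K[3]}]_3) : Prop :=
  forall i, g 0 i \is d.-homog.

Definition is_indeg (K : fieldType) (M : 'rV[{mpoly K[3]}]_3 -> Prop)
    (d : nat) : Prop :=
  (exists g, [/\ M g, g != 0 & homog_vec d g]) /\
  (forall e g, M g -> g != 0 -> homog_vec e g -> (d <= e)%N).

(* Main.v *)
Require Import Defs.
From HB Require Import structures.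
From mathcomp Require Import all_boot all_order all_algebra.
From mathcomp Require Import mpoly zify ring.

Set Implicit Arguments.
Unset Strict Implicit.
Unset Printing Implicit Defensive.

Import GRing.Theory.
Local Open Scope ring_scope.

(* Syzygies of the Jacobian ideal are the derivations [g] with [g f = 0], and
   such a derivation maps the form of every line [l] of the arrangement to a
   multiple of [l]. Hence the minor [D_ij = g_i x_j - g_j x_i], of degree
   [deg g + 1], vanishes on the lines through the point [x_i = x_j = 0].
   If [deg g <= s01 + s02], then on a line [l] through [x_0 = x_1 = 0] only, the
   relation [x_0 D_12 - x_1 D_02 + x_2 D_01 = 0] makes [D_12] proportional to
   [D_02]; so the restriction of [D_12] to [l] vanishes at the intersections
   with [x_0 = 0] and with all lines missing the point [x_0 = x_1 = 0]. These
   points are distinct by generality, and there are more of them than the degree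
   allows. Thus [D_12] vanishes on all such [l] as well, which again are too many
   lines, and [D_12 = 0]; the same degree count then kills [D_01] and [D_02], so
   [g] is a multiple of the Euler derivation and [g f = 0] forces [g = 0]. *)

(** * Homogeneous polynomials: derivatives, degrees and torsion *)

Lemma mderiv_homog n (R : nzRingType) d (p : {mpoly R[n]}) i :
  p \is d.+1.-homog -> p^`M(i) \is d.-homog.
Proof.
move=> hp; apply/dhomogP => m; rewrite mcoeff_msupp mcoeff_deriv => pm.
apply/eqP; rewrite -eqSS; apply: contraNT pm => dm.
by rewrite (dhomog_nemf_coeff hp) ?mul0rn //= mdegD mdeg1 addn1.
Qed.

Lemma msize_homog n (R : nzRingType) d (p : {mpoly R[n]}) :
  p \is d.-homog -> (msize p <= d.+1)%N.
Proof.
by move=> /dhomogP h; rewrite msizeE; apply/bigmax_leqP_seq => m /h ->.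
Qed.

Lemma mulrn_mpoly_eq0 n (K : fieldType) (p : {mpoly K[n]}) k :
  [pchar K] =i pred0 -> (0 < k)%N -> (p *+ k == 0) = (p == 0).
Proof.
move=> /pcharf0P chK k0; rewrite -mulr_natr mulf_eq0 -mpolyC_nat mpolyC_eq0.
by rewrite chK eqn0Ngt k0 orbF.
Qed.

(** * Linear forms and divisibility by them *)

Section LinearForms.
Variables (n : nat) (K : fieldType).
Implicit Types (l m p q : {mpoly K[n]}) (v : 'I_n -> K).

Lemma linear_formE l :
  l \is 1.-homog -> l = \sum_i l@_(U_(i)%MM) *: 'X_i.
Proof.
move=> hl; apply/mpolyP=> m; rewrite raddf_sum /=.
under eq_bigr do rewrite mcoeffZ mcoeffX.
have [/mdeg1P[i /eqP->]|hm] := boolP (mdeg m == 1%N).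
  rewrite (bigD1 i) //= eqxx mulr1 big1 ?addr0 // => j /negPf ji.
  by rewrite eq_mnm1 ji mulr0.
rewrite (dhomog_nemf_coeff hl hm) big1 // => i _.
case: eqP => [mE|_]; last by rewrite mulr0.
by rewrite -mE mdeg1 eqxx in hm.
Qed.

Lemma mderiv_linear_form l i :
  l \is 1.-homog -> l^`M(i) = (l@_(U_(i)%MM))%:MP.
Proof.
move=> hl; apply/mpolyP=> m; rewrite mcoeff_deriv mcoeffC.
have [->|m0] := eqVneq m 0%MM.
  by rewrite add0m mnm0E mulr1.
rewrite mulr0 (dhomog_nemf_coeff hl) ?mul0rn //.
by rewrite /= mdegD mdeg1 addn1 eqSS mdeg_eq0.
Qed.

Lemma meval_linear_form l v :
  l \is 1.-homog -> l.@[v] = \sum_i l@_(U_(i)%MM) * v i.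
Proof.
move=> hl; rewrite {1}(linear_formE hl) raddf_sum /=.
by apply: eq_bigr => i _; rewrite mevalZ mevalXU.
Qed.

Lemma linear_form_neq0 l :
  l \is 1.-homog -> l != 0 -> exists i, l@_(U_(i)%MM) != 0.
Proof.
move=> hl l0; apply/existsP; apply: contraNT l0 => /existsPn h0.
rewrite (linear_formE hl) big1 // => i _.
by move/negPn: (h0 i) => /eqP->; rewrite scale0r.
Qed.

Lemma msize_linear_form l : l \is 1.-homog -> l != 0 -> msize l = 2.
Proof.
move=> hl l0; have hs : (0 < msize l)%N by rewrite lt0n msize_poly_eq0.
have := dhomog_uniq l0 hl (dhomog_msize hl).
by case: (msize l) hs => //= k _ <-.
Qed.

Definition mdvd l p := exists q, p = q * l.

Lemma mdvd0 l : mdvd l 0.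
Proof. by exists 0; rewrite mul0r. Qed.

Lemma mdvd_mull l p q : mdvd l q -> mdvd l (p * q).
Proof. by case=> r ->; exists (p * r); rewrite mulrA. Qed.

Lemma mdvd_mulr l p q : mdvd l p -> mdvd l (p * q).
Proof. by rewrite mulrC; exact: mdvd_mull. Qed.

Lemma mdvdD l p q : mdvd l p -> mdvd l q -> mdvd l (p + q).
Proof. by move=> [r ->] [s ->]; exists (r + s); rewrite mulrDl. Qed.

(* Projection of the space of linear forms along [l]; a ring endomorphism with
   kernel [(l)] when [l.@[v] = 1]. *)
Definition elim_form l v p := p \mPo [tuple 'X_i - v i *: l | i < n].

Lemma elim_form_linear l v m : m \is 1.-homog ->
  elim_form l v m = m - m.@[v] *: l.
Proof.
move=> hm; rewrite (meval_linear_form _ hm) /elim_form {1 2}(linear_formE hm)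
  raddf_sum /=.
rewrite scaler_suml -sumrB; apply: eq_bigr => i _.
by rewrite comp_mpolyZ comp_mpolyXU -tnth_nth tnth_mktuple scalerBr scalerA.
Qed.

(** The substitution fixes every variable modulo [l], hence every monomial, by telescoping products
    and factoring differences of powers. *)
Lemma mdvd_sub_elim l v p : mdvd l (p - elim_form l v p).
Proof.
rewrite /elim_form comp_mpolyEX {1}[p]mpolyE -sumrB.
elim/big_rec: _ => [|m q _ IH]; first exact: mdvd0.
apply: mdvdD IH; rewrite -scalerBr -mul_mpolyC; apply: mdvd_mull.
rewrite comp_mpolyX mpolyXE_id.
elim/big_rec2: _ => [|i b a _ IH]; first by rewrite subrr; exact: mdvd0.
set t := tnth _ _.
have -> x y : x * a - y * b = x * (a - b) + b * (x - y) :> {mpoly K[n]} by ring.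
apply: mdvdD; apply: mdvd_mull => //.
rewrite /t tnth_mktuple subrXX; apply: mdvd_mulr.
by rewrite subKr -mul_mpolyC; exists (v i)%:MP.
Qed.

Lemma mdvd_elimP l v p : l \is 1.-homog -> l.@[v] = 1 ->
  mdvd l p <-> elim_form l v p = 0.
Proof.
move=> hl lv1; split=> [[q ->]|p0]; last first.
  by rewrite -[p]subr0 -p0; exact: mdvd_sub_elim.
rewrite /elim_form rmorphM /= -/(elim_form l v l) elim_form_linear //.
by rewrite lv1 scale1r subrr mulr0.
Qed.

Lemma ex_dual_vector l : l \is 1.-homog -> l != 0 -> exists v, l.@[v] = 1.
Proof.
move=> hl /(linear_form_neq0 hl) [i li].
exists (fun j => (j == i)%:R / l@_(U_(i)%MM)).
rewrite meval_linear_form // (bigD1 i) //= eqxx mul1r divff // big1 ?addr0 //.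
by move=> j /negPf->; rewrite mul0r mulr0.
Qed.

(** [elim_form l v] is a ring morphism into a domain, so its kernel is a prime ideal. *)
Lemma mdvd_prime l p q : l \is 1.-homog -> l != 0 ->
  mdvd l (p * q) -> mdvd l p \/ mdvd l q.
Proof.
move=> hl l0; have [v lv] := ex_dual_vector hl l0.
rewrite !(mdvd_elimP _ hl lv) /elim_form rmorphM /= => /eqP.
by rewrite mulf_eq0 => /orP[]/eqP; [left|right].
Qed.

Lemma mdvd_linear_form l m : l \is 1.-homog -> l != 0 -> m \is 1.-homog ->
  mdvd l m -> exists c, m = c *: l.
Proof.
move=> hl l0 hm; have [v lv] := ex_dual_vector hl l0.
rewrite (mdvd_elimP _ hl lv) elim_form_linear // => /eqP.
by rewrite subr_eq0 => /eqP mE; exists m.@[v].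
Qed.

Lemma msize_elim_form l v p : l \is 1.-homog ->
  (msize (elim_form l v p) <= msize p)%N.
Proof.
move=> hl; rewrite /elim_form comp_mpolyEX.
apply: leq_trans (msize_sum _ _ _) _; apply/bigmax_leqP_seq=> m mp _.
apply: leq_trans (msizeZ_le _ _) _; apply: leq_trans (msize_mdeg_lt mp).
rewrite comp_mpolyX; set t := [tuple _ | i < n].
apply: msize_homog; rewrite mdegE; elim/big_rec2: _ => [|i a b _ IH];
  first exact: dhomog1.
apply: dhomogM => //; have t1 : 'X_i - v i *: l \is 1.-homog.
  by rewrite rpredB ?rpredZ // dhomogX /= mdeg1.
by rewrite tnth_mktuple; have := dhomogMn (m i) t1; rewrite mul1n.
Qed.

End LinearForms.

(** * Line arrangements, derivations and minors *)

Section Arrangements.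
Variable K : fieldType.
Implicit Types (A L s : seq {mpoly K[3]}) (l m p q : {mpoly K[3]}).
Implicit Types (g : 'rV[{mpoly K[3]}]_3).

Lemma line_arrangement_cons l L : line_arrangement (l :: L) ->
  [/\ l != 0, l \is 1.-homog, line_arrangement L
    & {in L, forall m, ~ mdvd l m}].
Proof.
case=> /= /andP[lL uL] hL sL.
have [l0 hl] := hL l (mem_head _ _).
split=> // [|m mL].
  split=> // [m mL|m1 m2 h1 h2]; first by apply: hL; rewrite inE mL orbT.
  by apply: sL; rewrite inE ?h1 ?h2 orbT.
have mL' : m \in l :: L by rewrite inE mL orbT.
have [m0 hm] := hL m mL'.
case/(mdvd_linear_form hl l0 hm) => c mE.
have c0 : c != 0 by apply: contraNneq m0 => c0; rewrite mE c0 scale0r.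
have ml : m = l by apply: sL; rewrite ?mem_head //; exists c.
by rewrite -ml mL in lL.
Qed.

(** Distinct lines are non-associate primes and can be divided out of [p] one by one. As [msize] is
    the degree plus one, the bound puts the degree below the number of lines. *)
Lemma arrangement_mdvd_eq0 L p : line_arrangement L ->
  {in L, forall l, mdvd l p} -> (msize p <= size L)%N -> p = 0.
Proof.
elim: L p => [|l L IH] p; first by rewrite leqn0 msize_poly_eq0 => _ _ /eqP.
move=> /line_arrangement_cons[l0 hl aL nL] dv.
case: (dv l (mem_head _ _)) => q pE; rewrite pE in dv *.
have [-> _|q0] := eqVneq q 0; first by rewrite mul0r.
rewrite msizeM // (msize_linear_form hl l0) addn2 /= ltnS => sz.
rewrite (IH q) ?mul0r // => m mL.
have [m0 hm] : m != 0 /\ m \is 1.-homog by case: aL => _ /(_ m mL).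
have mq : mdvd m (q * l) by apply: dv; rewrite inE mL orbT.
case: (mdvd_prime hm m0 mq) => // ml; case: (nL m mL).
have [c lE] := mdvd_linear_form hm m0 hl ml.
have c0 : c != 0 by apply: contraNneq l0 => c0; rewrite lE c0 scale0r.
by exists (c^-1)%:MP; rewrite mul_mpolyC lE scalerA mulVf // scale1r.
Qed.

Definition der g p := \sum_i g 0 i * p^`M(i).

Lemma derM g p q : der g (p * q) = der g p * q + p * der g q.
Proof.
rewrite /der mulr_suml mulr_sumr -big_split; apply: eq_bigr => i _ /=.
by rewrite mderivM; ring.
Qed.

Lemma der_Euler s : {in s, forall l, l \is 1.-homog} ->
  der (\row_i 'X_i) (arr_poly s) = (arr_poly s) *+ size s.
Proof.
rewrite /arr_poly; elim: s => [|l s IH] hs.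
  by rewrite big_nil /der big1 // => i _; rewrite mderivC mulr0.
have hl := hs l (mem_head _ _).
rewrite big_cons derM IH => [|m ms]; last by apply: hs; rewrite inE ms orbT.
rewrite [size _]/= mulrS mulrnAr; congr (_ * _ + _).
rewrite {2}(linear_formE hl); apply: eq_bigr => i _.
by rewrite mxE mderiv_linear_form // mulrC mul_mpolyC.
Qed.

(** With [f = l h], the Leibniz rule makes [l] divide [der g l * h]; it is prime and divides no
    factor of [h]. *)
Lemma mdvd_der A g l : line_arrangement A -> l \in A ->
  der g (arr_poly A) = 0 -> mdvd l (der g l).
Proof.
move=> aA lA; rewrite /arr_poly; have := perm_to_rem lA => pA.
rewrite (perm_big _ pA) big_cons derM.
have {aA pA} /line_arrangement_cons[l0 hl _ nA] :
    line_arrangement (l :: rem l A).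
  case: aA => uA hA sA; split; first by rewrite -(perm_uniq pA).
    by move=> m; rewrite -(perm_mem pA); exact: hA.
  by move=> m1 m2; rewrite -!(perm_mem pA); exact: sA.
move/eqP; rewrite addr_eq0 => /eqP e.
have : mdvd l (der g l * \prod_(m <- rem l A) m).
  by rewrite e -mulrN mulrC; eexists.
case/(mdvd_prime hl l0) => //; elim: (rem l A) nA => [|m s IH] nA.
  rewrite big_nil => -[q q1]; have := congr1 (fun p => msize p) q1.
  have q0 : q != 0.
    by apply/eqP=> q0; move/eqP: q1; rewrite q0 mul0r oner_eq0.
  by rewrite msize1 msizeM // (msize_linear_form hl l0) addn2 /= => -[] /eqP;
    rewrite eq_sym msize_poly_eq0 (negPf q0).
rewrite big_cons => /(mdvd_prime hl l0) [/(nA _ (mem_head _ _)) //|].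
by apply: IH => m' ms; apply: nA; rewrite inE ms orbT.
Qed.

Lemma sum_ord3 (V : nmodType) (F : 'I_3 -> V) i j k : uniq [:: i; j; k] ->
  \sum_x F x = F i + F j + F k.
Proof.
move=> u; have := u; rewrite /= !inE negb_or andbT => /andP[/andP[ij ik] jk].
rewrite -addrA -[F k]addr0 (bigD1 i) //= (bigD1 j) /=; last by rewrite eq_sym.
rewrite (bigD1 k) /=; last by rewrite ![k == _]eq_sym ik.
rewrite big1 // => x; move: u {ij ik jk}.
by case: i j k x => [[|[|[|?]]] ?] [[|[|[|?]]] ?] [[|[|[|?]]] ?] [[|[|[|?]]] ?].
Qed.

(** A 2 by 2 minor of the matrix with rows [g] and the variables; these minors measure how far [g]
    is from a multiple of the Euler derivation. *)
Definition minor g i j := g 0 i * 'X_j - g 0 j * 'X_i.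

(** With [l = a x_i + b x_j], one has [a D_ij = x_j g(l) - g_j l] and [b D_ij = - x_i g(l) + g_i l],
    and [a] or [b] is nonzero. *)
Lemma mdvd_minor g l i j k : uniq [:: i; j; k] -> l \is 1.-homog -> l != 0 ->
  l@_(U_(k)%MM) = 0 -> mdvd l (der g l) -> mdvd l (minor g i j).
Proof.
move=> u hl l0 lk dl.
have lE : l = (l@_(U_(i)%MM))%:MP * 'X_i + (l@_(U_(j)%MM))%:MP * 'X_j.
  by rewrite {1}(linear_formE hl) (sum_ord3 _ u) lk scale0r addr0 !mul_mpolyC.
have dE : der g l = (l@_(U_(i)%MM))%:MP * g 0 i + (l@_(U_(j)%MM))%:MP * g 0 j.
  rewrite /der (sum_ord3 _ u) !mderiv_linear_form // lk mpolyC0 mulr0 addr0.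
  by rewrite mulrC [g 0 j * _]mulrC.
suff: exists2 c : K, c != 0 & mdvd l (c%:MP * minor g i j).
  case=> c c0 /(mdvd_mull c^-1%:MP).
  by rewrite mulrA -mpolyCM mulVf // mpolyC1 mul1r.
have [li|li] := eqVneq (l@_(U_(i)%MM)) 0; last first.
  exists l@_(U_(i)%MM) => //.
  have -> : (l@_(U_(i)%MM))%:MP * minor g i j = 'X_j * der g l + - g 0 j * l.
    move: lE dE; move: (l@_(U_(i)%MM))%:MP (l@_(U_(j)%MM))%:MP => a b lE dE.
    by rewrite dE lE /minor; ring.
  by apply: mdvdD; [exact: mdvd_mull|eexists].
exists l@_(U_(j)%MM).
  by apply: contraNneq l0 => lj; rewrite lE li lj mpolyC0 !mul0r addr0.
have -> : (l@_(U_(j)%MM))%:MP * minor g i j = - 'X_i * der g l + g 0 i * l.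
  move: lE dE; move: (l@_(U_(i)%MM))%:MP (l@_(U_(j)%MM))%:MP => a b lE dE.
  by rewrite dE lE /minor; ring.
by apply: mdvdD; [exact: mdvd_mull|eexists].
Qed.

Lemma through_coord_pt l i j k : uniq [:: i; j; k] -> l \is 1.-homog ->
  through (coord_pt K i j) l = (l@_(U_(k)%MM) == 0).
Proof.
move=> u hl; rewrite /through meval_linear_form // (sum_ord3 _ u) /coord_pt.
move: u; rewrite /= !inE negb_or andbT => /andP[/andP[_ ik] jk].
by rewrite !eqxx andbF !mulr0 !add0r ![k == _]eq_sym ik jk mulr1.
Qed.

Lemma arr_poly_homog s : {in s, forall l, l \is 1.-homog} ->
  arr_poly s \is (size s).-homog.
Proof.
rewrite /arr_poly; elim: s => [|l s IH] hs; first by rewrite big_nil dhomog1.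
rewrite big_cons; change (size (l :: s)) with (1 + size s)%N; apply: dhomogM;
  first exact: hs (mem_head _ _).
by apply: IH => m ms; apply: hs; rewrite inE ms orbT.
Qed.

Lemma coord_line_coef l (k x : 'I_3) c : l = c *: 'X_k ->
  l@_(U_(x)%MM) = (k == x)%:R * c.
Proof. by move=> ->; rewrite mcoeffZ mcoeffXU mulrC. Qed.

Lemma line_arrangement_filter A (P : pred {mpoly K[3]}) :
  line_arrangement A -> line_arrangement [seq l <- A | P l].
Proof.
case=> uA hA sA; split; first exact: filter_uniq.
  by move=> l; rewrite mem_filter => /andP[_ /hA].
by move=> l m; rewrite !mem_filter => /andP[_ lA] /andP[_ mA]; exact: sA.
Qed.

(** * Counting the lines of a triangular arrangement *)

Section Triangular.
Variable A : seq {mpoly K[3]}.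
Hypothesis aA : line_arrangement A.
Hypothesis triA : {in A, forall l, exists i, l@_(U_(i)%MM) == 0}.
Hypothesis cA : complete A.

(* [off i] selects the lines through the coordinate point whose only nonzero
   coordinate is the [i]-th one. *)
Definition off (i : 'I_3) : pred {mpoly K[3]} := fun l => l@_(U_(i)%MM) == 0.

Lemma homog_in l : l \in A -> l \is 1.-homog.
Proof. by case: aA => _ h _ /h[]. Qed.

Lemma neq0_in l : l \in A -> l != 0.
Proof. by case: aA => _ h _ /h[]. Qed.

Lemma off_third i j k l : uniq [:: i; j; k] -> l \in A ->
  ~~ off j l -> ~~ off k l -> off i l.
Proof.
move=> u /triA[x xl] jl kl; suff -> : i = x by [].
have : x != j by apply: contraNneq jl => <-.
have : x != k by apply: contraNneq kl => <-.
move: u {xl jl kl}; case: i j k x =>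
  [[|[|[|?]]] ?] [[|[|[|?]]] ?] [[|[|[|?]]] ?] [[|[|[|?]]] ?] //= _ _ _;
    exact: val_inj.
Qed.

(** A line through two coordinate points is the coordinate line joining them, which lies in [A] by
    completeness. *)
Lemma count_off2 i j k : uniq [:: i; j; k] ->
  count (predI (off i) (off j)) A = 1%N.
Proof.
move=> u; case: (cA k) => l lA [c c0 lE].
have := u; rewrite /= !inE negb_or andbT => /andP[/andP[ij ik] jk].
rewrite -[RHS]/(nat_of_bool true) -lA -count_uniq_mem; last by case: aA.
apply: eq_in_count => m mA /=; apply/andP/eqP => [[/eqP mi /eqP mj]|->];
  last first.
  by rewrite /off !(coord_line_coef _ lE) ![k == _]eq_sym (negPf ik) (negPf jk)
    mul0r eqxx.
have mE : m = m@_(U_(k)%MM) *: 'X_k.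
  by rewrite {1}(linear_formE (homog_in mA)) (sum_ord3 _ u) mi mj !scale0r
    !add0r.
have mk0 : m@_(U_(k)%MM) != 0.
  by apply: contraNneq (neq0_in mA) => mk; rewrite mE mk scale0r.
case: aA => _ _; apply=> //; exists (m@_(U_(k)%MM) / c);
  first by rewrite mulf_neq0 ?invr_neq0.
by rewrite {1}mE lE scalerA divfK.
Qed.

(** The lines left out are those of [off j] but one, by [count_off2]. Selections of this shape are
    the ones to which the degree counts apply. *)
Lemma count_off_orN i j k : uniq [:: i; j; k] ->
  (count (fun l => off i l || ~~ off j l) A + count (off j) A = (size A).+1)%N.
Proof.
move=> u; have := count_off2 u.
suff : (count (fun l => off i l || ~~ off j l) A + count (off j) A
    = size A + count (predI (off i) (off j)) A)%N by lia.
by elim: (A) => //= l s; case: (off i l); case: (off j l) => /=; lia.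
Qed.

(** Every line contains one or two coordinate points, and only the three coordinate lines contain
    two. *)
Lemma sum_count_off i j k : uniq [:: i; j; k] ->
  (count (off i) A + count (off j) A + count (off k) A = size A + 3)%N.
Proof.
move=> u; have u' : uniq [:: k; i; j] by move: u; rewrite -(rot_uniq 2).
have u'' : uniq [:: j; k; i] by move: u'; rewrite -(rot_uniq 2).
have := count_off2 u; have := count_off2 u'; have := count_off2 u''.
suff : (count (off i) A + count (off j) A + count (off k) A =
    size A + count (predI (off j) (off k)) A + count (predI (off k) (off i)) A
      + count (predI (off i) (off j)) A)%N by lia.
have : {in A, forall l, ~~ [&& off i l, off j l & off k l]
    /\ [|| off i l, off j l | off k l]}.
  move=> l lA; split.
    apply: contraNN (neq0_in lA) => /and3P[/eqP li /eqP lj /eqP lk].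
    by rewrite (linear_formE (homog_in lA)) (sum_ord3 _ u) li lj lk !scale0r
      !addr0.
  case jl : (off j l); rewrite ?orbT //.
  by case kl : (off k l); rewrite ?orbT // (off_third u) ?jl ?kl.
elim: (A) => [//|l s IH] offl /=.
have /IH : {in s, forall l, ~~ [&& off i l, off j l & off k l]
    /\ [|| off i l, off j l | off k l]} by move=> m ms; apply: offl;
      rewrite inE ms orbT.
have [] := offl l (mem_head _ _).
by case: (off i l); case: (off j l); case: (off k l) => //=; lia.
Qed.

(** * Restriction of a general arrangement to one of its lines *)

Hypothesis genA : general A.

(** Each of [l] and [m2] contains just one coordinate point, and not the same one, so they meet off
    the triangle; [m1] would be a third line through that point. *)
Lemma general_not_pencil i j k l m1 m2 (c c' : K) : uniq [:: i; j; k] ->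
  l \in A -> m1 \in A -> m2 \in A -> uniq [:: m1; m2; l] ->
  off k l -> ~~ off i l -> ~~ off j l -> off i m2 ->
  ~~ off j m2 -> ~~ off k m2 ->
  m1 = c *: m2 + c' *: l -> False.
Proof.
move=> u lA m1A m2A um lk li lj mi mj mk mE.
have := u; rewrite /= !inE negb_or andbT => /andP[/andP[ij ik] jk].
rewrite /off in lk li lj mi mj mk.
set a := l@_(U_(i)%MM) in li; set b := l@_(U_(j)%MM) in lj.
set q := m2@_(U_(j)%MM) in mj; set s := m2@_(U_(k)%MM) in mk.
(* [w] is the intersection point of [l] and [m2]. *)
pose w x := if x == i then - b else if x == j then a else - (a * q / s).
have wi : w i = - b by rewrite /w eqxx.
have wj : w j = a by rewrite /w [j == i]eq_sym (negPf ij) eqxx.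
have wk : w k = - (a * q / s).
  by rewrite /w ![k == _]eq_sym (negPf ik) (negPf jk).
have lw : l.@[w] = 0.
  rewrite meval_linear_form ?homog_in // (sum_ord3 _ u) (eqP lk) wi wj -/a -/b.
  by ring.
have m2w : m2.@[w] = 0.
  rewrite meval_linear_form ?homog_in // (sum_ord3 _ u) (eqP mi) wj wk -/q -/s.
  by field.
apply: (genA (v := w) m1A m2A lA um); last first.
  by rewrite /through {1}mE mevalD !mevalZ lw m2w !mulr0 addr0 eqxx.
move=> x; rewrite /w; case: (x == i); first by rewrite oppr_eq0.
by case: (x == j) => //; rewrite oppr_eq0 mulf_neq0 ?invr_neq0 // mulf_neq0.
Qed.

(** Lines with proportional restrictions to [l] lie in a pencil with [l]. If both are in [off j],
    the coefficient of ['X_j] forces the multiple of [l] to vanish; otherwise one contains only the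
    point of [off i], and [general_not_pencil] applies. *)
Lemma elim_form_inj i j k l v m1 m2 (c : K) : uniq [:: i; j; k] -> l \in A ->
  off k l -> ~~ off i l -> ~~ off j l ->
  m1 \in A -> m2 \in A -> off j m1 || ~~ off k m1 -> off j m2 || ~~ off k m2 ->
  c != 0 -> elim_form l v m1 = c *: elim_form l v m2 -> m1 = m2.
Proof.
move=> u lA lk li lj m1A m2A m1L m2L c0.
rewrite !elim_form_linear ?homog_in // => e.
have : m1 = c *: m2 + (m1.@[v] - c * m2.@[v]) *: l.
  rewrite -[LHS](subrK (m1.@[v] *: l)) e scalerBr scalerA scalerBl.
  by rewrite -addrA [- _ + _]addrC.
move: (_ - _) => c' mE {e}; apply/eqP/negPn/negP => m12.
have ml m : off j m || ~~ off k m -> m != l.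
  by apply: contraTneq => ->; rewrite (negPf lj) lk.
have um : uniq [:: m1; m2; l] by rewrite /= !inE negb_or m12 !ml.
have um' : uniq [:: m2; m1; l].
  by rewrite /= !inE negb_or [m2 == m1]eq_sym m12 !ml.
have [c'0|c'0] := eqVneq c' 0.
  move: m12; rewrite c'0 scale0r addr0 in mE; case/eqP.
  by case: aA => _ _; apply=> //; exists c.
have mcoefE x : m1@_(U_(x)%MM) = c * m2@_(U_(x)%MM) + c' * l@_(U_(x)%MM).
  by rewrite mE mcoeffD !mcoeffZ.
have [mj2|mj2] := boolP (off j m2); last first.
  rewrite (negPf mj2) /= in m2L.
  exact: (general_not_pencil u lA m1A m2A um lk li lj (off_third u m2A mj2 m2L)
    mj2 m2L mE).
have [mj1|mj1] := boolP (off j m1).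
  have := mcoefE j; rewrite (eqP mj1) (eqP mj2) mulr0 add0r => /esym/eqP.
  by rewrite mulf_eq0 (negPf c'0) -/(off j l) (negPf lj).
rewrite (negPf mj1) /= in m1L.
(* Solving the relation for [m2] exchanges the roles of the two lines. *)
apply: (general_not_pencil (c := c^-1) (c' := - (c^-1 * c')) u lA m2A m1A um'
  lk li lj (off_third u m1A mj1 m1L) mj1 m1L).
by rewrite mE scalerDr !scalerA mulVf // scale1r scaleNr addrK.
Qed.

(** The forms cut out distinct points of [l], so [arrangement_mdvd_eq0] also counts zeros on [l].
    Selected are the lines missing the point of [off k], and the line [x_i = 0]. *)
Lemma elim_line_arrangement i j k l v : uniq [:: i; j; k] -> l \in A ->
  off k l -> ~~ off i l -> ~~ off j l ->
  line_arrangement [seq elim_form l v m | m <- A & off j m || ~~ off k m].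
Proof.
move=> u lA lk li lj; split.
- rewrite map_inj_in_uniq; first by apply: filter_uniq; case: aA.
  move=> m1 m2; rewrite !mem_filter => /andP[m1L m1A] /andP[m2L m2A] e.
  apply: (elim_form_inj (v := v) u lA lk li lj m1A m2A m1L m2L (oner_neq0 _)).
  by rewrite scale1r.
- move=> _ /mapP[m + ->]; rewrite mem_filter => /andP[mL mA].
  have hm := homog_in mA; have hl := homog_in lA.
  rewrite elim_form_linear //; split; last by rewrite rpredB ?rpredZ.
  apply/eqP=> /eqP; rewrite subr_eq0 => /eqP mE.
  have ml : m = l.
    case: aA => _ _; apply=> //; exists m.@[v] => //.
    by apply: contraNneq (neq0_in mA) => m0; rewrite mE m0 scale0r.
  by move: mL; rewrite ml (negPf lj) lk.
- move=> _ _ /mapP[m1 + ->] /mapP[m2 + ->] [c c0 cE].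
  rewrite !mem_filter => /andP[m1L m1A] /andP[m2L m2A].
  by rewrite (elim_form_inj u lA lk li lj m1A m2A m1L m2L c0 cE).
Qed.

(** * Vanishing of the minors for derivations of low degree *)

Section MinorsVanish.
Variable g : 'rV[{mpoly K[3]}]_3.
Hypothesis dA : {in A, forall l, mdvd l (der g l)}.
Variables i j k : 'I_3.
Hypothesis u : uniq [:: i; j; k].
Hypothesis sD : forall x y,
  (msize (minor g x y) + 2 <= count (off j) A + count (off k) A)%N.
Hypothesis le_ji : (count (off j) A <= count (off i) A)%N.
Hypothesis le_ki : (count (off k) A <= count (off i) A)%N.

Let uik : uniq [:: i; k; j].
Proof.
by move: u; rewrite /= !inE !negb_or [k == j]eq_sym [(i != k) && _]andbC.
Qed.

Let ujk : uniq [:: j; k; i].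
Proof. by move: u; rewrite -(rot_uniq 1). Qed.

Lemma minorC x y : minor g x y = - minor g y x.
Proof. by rewrite /minor opprB. Qed.

Lemma mdvd_minor_off x y z l : uniq [:: x; y; z] -> l \in A -> off z l ->
  mdvd l (minor g x y).
Proof.
move=> uxyz lA /eqP lz.
by apply: (mdvd_minor uxyz _ _ lz (dA lA)); [exact: homog_in|exact: neq0_in].
Qed.

(** Expansion of a 3 by 3 determinant with two rows of variables and one row [g]. *)
Lemma plucker_rel :
  'X_j * minor g i k = 'X_i * minor g j k + 'X_k * minor g i j.
Proof. by rewrite /minor; ring. Qed.

Lemma not_mdvd_coord l x y : l \is 1.-homog -> l != 0 -> x != y ->
  ~~ off y l -> ~ mdvd l 'X_x.
Proof.
move=> hl l0 xy ly /(mdvd_linear_form hl l0)[|c Xx];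
  first by rewrite dhomogX /= mdeg1.
have := congr1 (mcoeff U_(y)%MM) Xx; rewrite mcoeffZ mcoeffXU (negPf xy) =>
  /esym/eqP.
rewrite mulf_eq0 -/(off y l) (negPf ly) orbF => /eqP c0.
have := congr1 (mcoeff U_(x)%MM) Xx; rewrite c0 scale0r mcoeff0 mcoeffXU eqxx.
by move/eqP; rewrite oner_eq0.
Qed.

Lemma mdvd_minor_jk l : l \in A -> off k l -> ~~ off i l -> ~~ off j l ->
  mdvd l (minor g j k).
Proof.
move=> lA lk li lj.
have hl := homog_in lA; have l0 := neq0_in lA.
have [v lv] := ex_dual_vector hl l0.
have /(mdvd_elimP _ hl lv) phi_ij := mdvd_minor_off u lA lk.
rewrite (mdvd_elimP _ hl lv); set phi := elim_form l v in phi_ij *.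
have phiD p q : phi (p + q) = phi p + phi q by rewrite /phi /elim_form raddfD.
have phiZ c p : phi (c *: p) = c *: phi p by rewrite /phi /elim_form
  comp_mpolyZ.
have phiM p q : phi (p * q) = phi p * phi q by rewrite /phi /elim_form rmorphM.
(* On [l], [D_ij] vanishes and [x_j] is a multiple of the nonzero [x_i], so [x_i] cancels from
   [plucker_rel]. *)
have [c phiE] : exists c : K, phi (minor g j k) = c *: phi (minor g i k).
  have lE : l = l@_(U_(i)%MM) *: 'X_i + l@_(U_(j)%MM) *: 'X_j.
    by rewrite {1}(linear_formE hl) (sum_ord3 _ u) (eqP lk) scale0r addr0.
  have eij : l@_(U_(i)%MM) *: phi 'X_i + l@_(U_(j)%MM) *: phi 'X_j = 0.
    by rewrite -!phiZ -phiD -lE; apply/(mdvd_elimP _ hl lv); exists 1;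
      rewrite mul1r.
  have Xj : phi 'X_j = (- (l@_(U_(j)%MM))^-1 * l@_(U_(i)%MM)) *: phi 'X_i.
    move/eqP: eij; rewrite addr_eq0 => /eqP eij.
    by rewrite mulNr scaleNr -scalerA eij scalerN opprK scalerA mulVf //
      scale1r.
  have Xi0 : phi 'X_i != 0.
    apply/eqP=> /(mdvd_elimP _ hl lv); apply: (not_mdvd_coord hl l0 _ lj).
    by move: u; rewrite /= !inE negb_or => /andP[/andP[]].
  move: Xj; move: (_ * _) => c Xj; exists c.
  have := congr1 phi plucker_rel; rewrite phiD !phiM phi_ij mulr0 addr0 => e.
  by apply: (mulfI Xi0); rewrite -e Xj -scalerAl scalerAr.
apply: (arrangement_mdvd_eq0 (elim_line_arrangement v u lA lk li lj)).
  move=> _ /mapP[m + ->]; rewrite mem_filter => /andP[mL mA].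
  have dphi p : mdvd m p -> mdvd (phi m) (phi p).
    by case=> q ->; rewrite phiM; eexists.
  (* A selected line outside [off j] is in [off i] and divides [D_jk] itself; one in [off j] divides
     [D_ik], which suffices by [phiE]. *)
  have [mj|mj] := boolP (off j m); last first.
    rewrite (negPf mj) /= in mL; apply: dphi; apply: (mdvd_minor_off ujk mA).
    exact: (off_third u mA mj mL).
  rewrite phiE -mul_mpolyC; apply/mdvd_mull/dphi.
  exact: mdvd_minor_off uik mA mj.
(* There are [count (off i) A + count (off j) A - 2] points, enough for [sD] by [le_ki]. *)
apply: leq_trans (msize_elim_form v _ hl) _; rewrite size_map size_filter.
have := count_off_orN ujk; have := sum_count_off u.
have := sD j k; move: le_ji le_ki; lia.
Qed.

Lemma minors_eq0 : [/\ minor g j k = 0, minor g i k = 0 & minor g i j = 0].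
Proof.
have ukij : uniq [:: k; i; j] by move: u; rewrite -(rot_uniq 2).
have ki : k != i by move: ukij; rewrite /= !inE negb_or => /andP[/andP[]].
have Djk : minor g j k = 0.
  apply: (arrangement_mdvd_eq0
            (line_arrangement_filter (fun l => off i l || ~~ off j l) aA)).
    move=> l; rewrite mem_filter => /andP[lij lA].
    have [li|li] := boolP (off i l); first exact: mdvd_minor_off ujk lA li.
    rewrite (negPf li) /= in lij; apply: (mdvd_minor_jk lA _ li lij).
    exact: (off_third ukij lA li lij).
  (* There are [count (off i) A + count (off k) A - 2] lines, enough by [le_ji]. *)
  rewrite size_filter.
  have := count_off_orN u; have := sum_count_off u.
  by have := sD j k; move: le_ji le_ki; lia.
have jk_eq : 'X_j * minor g i k = 'X_k * minor g i j.
  by rewrite plucker_rel Djk mulr0 add0r.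
have Dij : minor g i j = 0.
  apply: (arrangement_mdvd_eq0
            (line_arrangement_filter (fun l => off k l || ~~ off i l) aA)).
    move=> l; rewrite mem_filter => /andP[lki lA].
    have [lk|lk] := boolP (off k l); first exact: mdvd_minor_off u lA lk.
    rewrite (negPf lk) /= in lki.
    have hl := homog_in lA; have l0 := neq0_in lA.
    (* Here [l] is in [off j], so it divides [D_ik]; it does not divide [x_k], as its [x_i]
       coefficient is nonzero. *)
    have : mdvd l ('X_k * minor g i j).
      rewrite -jk_eq; apply/mdvd_mull/(mdvd_minor_off uik lA).
      exact: (off_third ujk lA lk lki).
    by case/(mdvd_prime hl l0) => // /(not_mdvd_coord hl l0 ki lki).
  (* The number of lines, [count (off j) A + count (off k) A - 2], is exactly what [sD] allows. *)
  rewrite size_filter.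
  have := count_off_orN ukij; have := sum_count_off u.
  by have := sD i j; move: le_ji le_ki; lia.
split=> //; have /eqP := jk_eq; rewrite Dij mulr0 mulf_eq0 => /orP[]/eqP // Xj0.
by have := msizeX K U_(j)%MM; rewrite Xj0 msize0.
Qed.

End MinorsVanish.

End Triangular.
End Arrangements.

(** * The upper bound: an explicit syzygy *)

Lemma syz_jacobianE (K : fieldType) (f : {mpoly K[3]}) g :
  syz (jacobian_gens f) g <-> der g f = 0.
Proof.
by rewrite /syz /der; under eq_bigr do rewrite mxE.
Qed.

(* With [f = F G], where [G] collects the lines through the point
   [x_1 = x_2 = 0], the derivation [deg f * F d_0 - (d_0 F) * Euler] kills [f]
   because [d_0 G = 0]. *)
Lemma ex_syzygy (K : fieldType) (A : seq {mpoly K[3]}) d :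
  [pchar K] =i pred0 -> line_arrangement A ->
  count (predC (off i0)) A = d.+1 ->
  exists g, [/\ der g (arr_poly A) = 0, g != 0 & homog_vec d.+1 g].
Proof.
move=> chK aA cF.
pose s := [seq l <- A | ~~ off i0 l]; pose F := arr_poly s.
pose G := arr_poly [seq l <- A | off i0 l].
have hA l : l \in A -> l \is 1.-homog by exact: homog_in.
have fE : arr_poly A = F * G.
  by rewrite /F /G /arr_poly !big_filter [LHS](bigID (off i0)) mulrC.
have hF : F \is d.+1.-homog.
  have -> : d.+1 = size s by rewrite -cF -size_filter.
  by apply: arr_poly_homog => l; rewrite mem_filter => /andP[_ /hA].
have G0 : G^`M(i0) = 0.
  rewrite /G /arr_poly big_filter.
  have: {in A, forall l, l \is 1.-homog} by [].
  elim: (A) => [|l r IH] hr; first by rewrite big_nil mderivC.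
  have hr' : {in r, forall l, l \is 1.-homog} by move=> m mr; apply: hr;
    rewrite inE mr orbT.
  rewrite big_cons; case: ifP => [/eqP l0|_]; last exact: IH.
  by rewrite mderivM IH // mulr0 addr0 mderiv_linear_form ?hr ?mem_head // l0
    mpolyC0 mul0r.
have A0 : (0 < size A)%N by rewrite -(count_predC (off i0)) cF addnS.
have F0 : F != 0.
  rewrite /F /arr_poly prodf_seq_neq0; apply/allP=> l; rewrite mem_filter =>
    /andP[_ lA].
  by apply/implyP => _; exact: neq0_in lA.
pose g : 'rV[{mpoly K[3]}]_3 :=
  \row_i ((F *+ size A) *+ (i == i0) - F^`M(i0) * 'X_i).
have gE p : der g p = F *+ size A * p^`M(i0) - F^`M(i0) * der (\row_i 'X_i) p.
  rewrite /der; under eq_bigr do rewrite mxE mulrBl.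
  rewrite sumrB (bigD1 i0) //= mulr1n big1 ?addr0; last first.
    by move=> i /negPf->; rewrite mulr0n mul0r.
  by congr (_ - _); rewrite mulr_sumr; apply: eq_bigr => i _; rewrite mxE mulrA.
exists g; split.
- rewrite gE der_Euler // fE mderivM G0 mulr0 addr0.
  by rewrite mulrnAl mulrnAr; apply/eqP; rewrite subr_eq0; apply/eqP;
    congr (_ *+ _); ring.
(* If [g = 0], the entry at [i1] gives [d_0 F = 0], and then the entry at [i0] gives
   [deg f * F = 0], impossible in characteristic 0. *)
- apply/eqP=> g0.
  have := congr1 (fun h : 'rV[{mpoly K[3]}]_3 => h 0 i1) g0;
    rewrite !mxE /= mulr0n sub0r => /eqP.
  rewrite oppr_eq0 mulf_eq0 => /orP[/eqP F'0|/eqP X0]; last first.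
    by have := msizeX K U_(i1)%MM; rewrite X0 msize0.
  have := congr1 (fun h : 'rV[{mpoly K[3]}]_3 => h 0 i0) g0;
    rewrite !mxE F'0 mul0r subr0 eqxx mulr1n.
  by move/eqP; rewrite mulrn_mpoly_eq0 // (negPf F0).
- move=> i; rewrite mxE rpredB ?rpredMn //.
  change d.+1 with (1 + d)%N; rewrite mulrC.
  by apply: dhomogM; [rewrite dhomogX /= mdeg1|exact: mderiv_homog].
Qed.

(** * Combining the explicit syzygy with the vanishing of the minors *)

Lemma ord3_ind (P : 'I_3 -> Prop) : P i0 -> P i1 -> P i2 -> forall x, P x.
Proof.
move=> P0 P1 P2 [[|[|[|//]]] hx].
- by rewrite (_ : Ordinal hx = i0) //; exact: val_inj.
- by rewrite (_ : Ordinal hx = i1) //; exact: val_inj.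
- by rewrite (_ : Ordinal hx = i2) //; exact: val_inj.
Qed.

Theorem proposition4p2 (K : closedFieldType) (charK : [pchar K] =i pred0)
    (s01 s02 s12 : nat) (hs01 : (1 <= s01)%N) (hs02 : (1 <= s02)%N)
    (hs12 : (1 <= s12)%N) (hle1 : (s01 <= s02)%N) (hle2 : (s02 <= s12)%N)
    (A : seq {mpoly K[3]}) (hA : in_H s01 s02 s12 A) (hgen : general A) :
  is_indeg (syz (jacobian_gens (arr_poly A))) (s01 + s02 + 1)%N.
Proof.
case: hA => -[aA tri] cA; rewrite /lines_through.
have u : uniq [:: i0; i1; i2] by [].
have thE i j k : uniq [:: i; j; k] ->
    count (through (coord_pt K i j)) A = count (off k) A.
  by move=> uijk; apply: eq_in_count => l /(homog_in aA) hl;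
    exact: through_coord_pt.
rewrite (thE _ _ i2) // (thE _ _ i1) // (thE _ _ i0) // => n2 n1 n0.
have triA : {in A, forall l, exists i, l@_(U_(i)%MM) == 0}.
  move=> l lA; have [i [j [ij]]] := tri l lA.
  have [k uijk] : exists k, uniq [:: i; j; k].
    move: i j ij => [[|[|[|?]]] ?] [[|[|[|?]]] ?] //= _;
      by [exists i2 | exists i1 | exists i0].
  by rewrite (through_coord_pt uijk) ?(homog_in aA) //; exists k.
have := sum_count_off aA triA cA u; rewrite n0 n1 n2 => szA.
split.
  (* Of the [s01 + s02 + s12 + 3] lines, [s12 + 2] are in [off i0], leaving [s01 + s02 + 1]. *)
  have [|g [g1 g2 g3]] := ex_syzygy (d := (s01 + s02)%N) charK aA.
    by have := count_predC (off i0) A; lia.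
  by exists g; rewrite addn1; split=> //; apply/syz_jacobianE.
move=> e g /syz_jacobianE dg g0 hg; rewrite leqNgt;
  apply: contra_neqN g0 => lt_e.
(* The minor has degree [e + 1], so [msize] at most [e + 2]; the counts add up to [s01 + s02 + 4],
   and [e <= s01 + s02]. *)
have sD x y :
    (msize (minor g x y) + 2 <= count (off i1) A + count (off i2) A)%N.
  have /msize_homog : minor g x y \is (e + 1).-homog.
    by rewrite rpredB //; apply: dhomogM => //; rewrite dhomogX /= mdeg1.
  by lia.
have dA : {in A, forall l, mdvd l (der g l)} by move=> l lA;
  exact: mdvd_der lA dg.
have [||D12 D02 D01] := minors_eq0 aA triA cA hgen dA u sD; try lia.
have Dxy x y : g 0 x * 'X_y = g 0 y * 'X_x.
  apply/eqP; rewrite -subr_eq0 -/(minor g x y); apply/eqP; move: x y.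
  have Dxx z : minor g z z = 0 by rewrite /minor subrr.
  have D10 : minor g i1 i0 = 0 by rewrite minorC D01 oppr0.
  have D20 : minor g i2 i0 = 0 by rewrite minorC D02 oppr0.
  have D21 : minor g i2 i1 = 0 by rewrite minorC D12 oppr0.
  by do 2!apply: ord3_ind.
apply/rowP=> x; rewrite mxE; apply/eqP.
(* By [Dxy], [g_x] times the Euler derivation equals [x_x] times the derivation of [g], which kills
   [f]. *)
have : g 0 x * (arr_poly A *+ size A) = 0.
  rewrite -der_Euler; last exact: homog_in.
  rewrite /der mulr_sumr; under eq_bigr => y _ do rewrite mxE mulrA Dxy.
  transitivity ('X_x * der g (arr_poly A)); last by rewrite dg mulr0.
  by rewrite /der mulr_sumr; apply: eq_bigr => y _; rewrite mulrCA mulrA.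
have A0 : (0 < size A)%N by rewrite -(ltn_add2r 3) -szA; lia.
move/eqP; rewrite mulf_eq0 mulrn_mpoly_eq0 // => /orP[//|].
rewrite /arr_poly prodf_seq_eq0 => /hasP[l lA /= l0].
by have := neq0_in aA lA; rewrite l0.
Qed.
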